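(* For a space $X$ and an infinite set $\mathcal{A}$, the following are equivalent: (i) Each convex-valued l.s.c. mapping $\Phi:X\rightrightarrows\mathbf{c}_{00}(\mathcal{A})$ has, for every $\varepsilon>0$, a continuous $\varepsilon$-selection. (ii) Each convex-valued l.s.c. mapping $\Phi:X\rightrightarrows\ell_1(\mathcal{A})$ has, for every $\varepsilon>0$, a continuous $\varepsilon$-selection. (iii) Each open cover $\{U_\alpha:\alpha\in\mathcal{A}\}$ of $X$ indexed by $\mathcal{A}$ has an index-subordinated partition of unity.
   Context: $\ell_1(\mathcal{A})$ is the Banach space of $y:\mathcal{A}\to\mathbb{R}$ with $\|y\|_1=\sum_\alpha|y(\alpha)|<\infty$; $\mathbf{c}_{00}(\mathcal{A})$ is its (normed, non-complete) subspace of finitely supported functions with the $\|\cdot\|_1$ norm. A set-valued mapping $\Phi:X\rightrightarrows Y$ assigns nonempty subsets; it is l.s.c. if $\{x:\Phi(x)\cap U\ne\emptyset\}$ is open for every open $U\subseteq Y$, and convex-valued if every $\Phi(x)$ is convex. For a metric space $(Y,d)$, a map $f:X\to Y$ is an $\varepsilon$-selection for $\Phi$ if for every $x$ there is $y\in\Phi(x)$ with $d(f(x),y)<\varepsilon$. A partition of unity indexed by $\mathcal{A}$ is a family of continuous $\xi_\alpha:X\to[0,1]$ with $\sum_\alpha\xi_\alpha(x)=1$ for all $x$; it is index-subordinated to $\{U_\alpha\}$ if $\{x:\xi_\alpha(x)\neq0\}\subseteq U_\alpha$ for all $\alpha$. *)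

(* Defs.v *)
From HB Require Import structures.
From mathcomp Require Import all_boot all_order all_algebra.
From mathcomp Require Import all_classical all_reals all_analysis.
Set Implicit Arguments. Unset Strict Implicit. Unset Printing Implicit Defensive.
Import Order.TTheory GRing.Theory Num.Theory numFieldTopology.Exports numFieldNormedType.Exports.
Local Open Scope classical_set_scope.
Local Open Scope ring_scope.

Section L1.
Variables (R : realType) (A : choiceType).

Definition l1norm (y : A -> R) : \bar R := \esum_(a in [set: A]) (`|y a|)%:E.

Definition ell1 : set (A -> R) := [set y | (l1norm y < +oo)%E].

(* c_00(A): finitely supported functions (with the l_1 norm) *)
Definition c00 : set (A -> R) := [set y | finite_set [set a | y a != 0]].

Definition l1dist (y z : A -> R) : \bar R := l1norm (y - z).

Definition open_in (S U : set (A -> R)) : Prop :=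
  U `<=` S /\
  forall y, U y -> exists2 r : R, 0 < r &
    forall z, S z -> (l1dist z y < r%:E)%E -> U z.

Definition convex_set (C : set (A -> R)) : Prop :=
  forall y z (t : R), C y -> C z -> 0 <= t -> t <= 1 ->
    C (t *: y + (1 - t) *: z).

Variable X : topologicalType.

Definition setvalued_into (S : set (A -> R)) (Phi : X -> set (A -> R)) : Prop :=
  forall x, Phi x !=set0 /\ Phi x `<=` S.

Definition lsc (S : set (A -> R)) (Phi : X -> set (A -> R)) : Prop :=
  forall U, open_in S U -> open [set x | Phi x `&` U !=set0].

Definition convex_valued (Phi : X -> set (A -> R)) : Prop :=
  forall x, convex_set (Phi x).

Definition continuous_into (S : set (A -> R)) (f : X -> A -> R) : Prop :=
  (forall x, S (f x)) /\
  forall x (e : R), 0 < e -> \forall x' \near x, (l1dist (f x') (f x) < e%:E)%E.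

Definition eps_selection (Phi : X -> set (A -> R)) (eps : R) (f : X -> A -> R) : Prop :=
  forall x, exists2 y, Phi x y & (l1dist (f x) y < eps%:E)%E.

Definition selection_property (S : set (A -> R)) : Prop :=
  forall Phi : X -> set (A -> R),
    setvalued_into S Phi -> convex_valued Phi -> lsc S Phi ->
    forall eps : R, 0 < eps ->
      exists f : X -> A -> R, continuous_into S f /\ eps_selection Phi eps f.

Definition partition_of_unity (xi : A -> X -> R) : Prop :=
  (forall a, continuous (xi a)) /\
  (forall a x, 0 <= xi a x <= 1) /\
  (forall x, \esum_(a in [set: A]) (xi a x)%:E = 1%E).

Definition index_subordinated (xi : A -> X -> R) (U : A -> set X) : Prop :=
  forall a, [set x | xi a x != 0] `<=` U a.

Definition open_cover_indexed (U : A -> set X) : Prop :=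
  (forall a, open (U a)) /\ \bigcup_(a in [set: A]) U a = [set: X].

End L1.

(* Main.v *)
Require Import Defs.
From HB Require Import structures.
From mathcomp Require Import all_boot all_order all_algebra.
From mathcomp Require Import all_classical all_reals all_analysis.
From mathcomp Require Import finmap ring lra.
Set Implicit Arguments. Unset Strict Implicit. Unset Printing Implicit Defensive.
Import Order.TTheory GRing.Theory Num.Theory.
Import numFieldTopology.Exports numFieldNormedType.Exports.
Local Open Scope classical_set_scope.
Local Open Scope ring_scope.

(* Both selection properties are compared with the partition property, for an
   arbitrary [S] with [c00 `<=` S `<=` ell1].

   From partitions to selections: since [A] is infinite, [|A * A| = |A|], so the
   finitely supported rational functions, which are dense in [ell1], can be
   enumerated as [d a], [a : A].  The sets of those [x] for which [Phi x] meets the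
   ball of radius [e / 2] about [d a] form an open cover.  A partition of unity
   subordinated to it is turned into a locally finite family [m], and the
   barycenter of the [d a] with weights [m a x] is the [e]-selection.

   From selections to partitions: for a cover [U], let [Phi x] be the convex hull of
   the unit vectors [e_a] with [U a x].  A vector that lies in [Phi x] lies in
   [Phi x'] for all [x'] near [x], so that [Phi], as well as its intersections with
   balls centered at a continuous function, is l.s.c.  Iterating yields selections
   up to [2^-n] whose uniform limit is a selection of the closure of [Phi] in
   [ell1]; its coordinates form the partition. *)

(** * Pairings on infinite types *)

Lemma infinite_nat_inj (T : Type) :
  infinite_set [set: T] -> exists i : nat -> T, injective i.
Proof.
move=> /infiniteP/card_leP [i0]; exists (fun n => \val (i0 (to_setT n))).
move=> m n /val_inj /(@inj _ _ _ i0) => h.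
by have := h (mem_set I) (mem_set I) => /(congr1 val).
Qed.

Lemma subset_chain2 (T : Type) (F : set (set T)) (x y : T) :
  total_on F subset -> (\bigcup_(X in F) X) x -> (\bigcup_(X in F) X) y ->
  exists2 X, F X & X x /\ X y.
Proof.
move=> tF [X FX Xx] [Y FY Yy].
by have [/(_ _ Xx) ?|/(_ _ Yy) ?] := tF _ _ FX FY; [exists Y|exists X].
Qed.

(** Comparability of cardinals. Zorn's lemma gives a maximal graph of a partial injection from [B]
    to [C]; if it missed a point on both sides, that pair could be added. *)
Lemma injection_total (T U : Type) (B : set T) (C : set U) :
  (exists r : T -> U -> Prop, [/\ forall b, B b -> exists2 c, C c & r b c &
     forall b b' c, r b c -> r b' c -> b = b']) \/
  (exists r : U -> T -> Prop, [/\ forall c, C c -> exists2 b, B b & r c b &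
     forall c c' b, r c b -> r c' b -> c = c']).
Proof.
pose P (G : set (T * U)) := [/\ G `<=` B `*` C,
  forall b c c', G (b, c) -> G (b, c') -> c = c' &
  forall b b' c, G (b, c) -> G (b', c) -> b = b'].
have [F FP tF|G [[GBC Gf Gi] Gmax]] := @Zorn_bigcup _ P.
  split.
  - by move=> p [X FX]; case: (FP _ FX) => + _ _; apply.
  - move=> b c c' h h'; have [X FX [X1 X2]] := subset_chain2 tF h h'.
    by case: (FP _ FX) => _ + _; apply; eassumption.
  - move=> b b' c h h'; have [X FX [X1 X2]] := subset_chain2 tF h h'.
    by case: (FP _ FX) => _ _; apply; eassumption.
have [hB|/existsNP[b /not_implyP[Bb nb]]] :=
    pselect (forall b, B b -> exists c, G (b, c)).
  left; exists (fun b c => G (b, c)); split; last exact: Gi.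
  by move=> b /hB[c Gc]; exists c => //; exact: (GBC _ Gc).2.
have [hC|/existsNP[c /not_implyP[Cc nc]]] :=
    pselect (forall c, C c -> exists b, G (b, c)).
  right; exists (fun c b => G (b, c)); split=> [c /hC[b' Gb]|c c' b']; last exact: Gf.
  by exists b' => //; exact: (GBC _ Gb).1.
exfalso; apply: (Gmax (G `|` [set (b, c)])).
  split=> [x Gx|/(_ (b, c))]; first by left.
  by move=> /(_ (or_intror erefl)) Gbc; apply: nb; exists c.
split.
- by move=> x [/GBC//|->].
- move=> b1 c1 c2 [h1|[-> ->]] [h2|[]].
  + exact: Gf h1 h2.
  + by move=> e _; case: nb; exists c1; rewrite -e.
  + by case: nb; exists c2.
  + by [].
- move=> b1 b2 c1 [h1|[-> ->]] [h2|[]].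
  + exact: Gi h1 h2.
  + by move=> _ e; case: nc; exists b1; rewrite -e.
  + by case: nc; exists b2.
  + by [].
Qed.

(** Reading the domain off the diagonal lets the graph alone carry both the set and the injection,
    so that Zorn's lemma applies to plain sets of triples. *)
Definition pairing_dom (A : Type) (G : set (A * A * A)) : set A := [set a | exists c, G (a, a, c)].

(* [G] is the graph of an injection [D * D -> D], with [D := pairing_dom G]. *)
Definition pairing (A : Type) (G : set (A * A * A)) : Prop :=
  [/\ forall p c c', G (p, c) -> G (p, c') -> c = c',
      forall p p' c, G (p, c) -> G (p', c) -> p = p',
      forall a b c, G (a, b, c) -> [/\ pairing_dom G a, pairing_dom G b & pairing_dom G c] &
      forall a b, pairing_dom G a -> pairing_dom G b -> exists c, G (a, b, c)].

(** A maximal pairing on a subset [D] is compared with the complement of [D]. If the complement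
    injects into [D], so does all of [A], and the pairing transfers. If [D] injects into its
    complement, the pairing extends to [D] together with that copy, against maximality. *)
Lemma infinite_pairing (A : Type) :
  infinite_set [set: A] -> exists p : A * A -> A, injective p.
Proof.
move=> /infinite_nat_inj [i i_inj].
(* The seed, a pairing on a countable set; its points [i n] serve as tags later on. *)
pose G0 := [set q : A * A * A | exists m n,
  q = (i m, i n, i (choice.pickle (m, n)))].
have pG0 : pairing G0.
  have dG0 a : pairing_dom G0 a <-> exists n, a = i n.
    split=> [[c [m [n [-> _ _]]]]|[n ->]]; first by exists m.
    by exists (i (choice.pickle (n, n))), n, n.
  split.
  - move=> p c c' [m [n [-> ->]]] [m' [n' [/i_inj e1 /i_inj e2 ->]]].
    by rewrite e1 e2.
  - move=> p p' c [m [n [-> ->]]] [m' [n' [-> /i_inj]]].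
    by move=> /(pcan_inj choice.pickleK)[-> ->].
  - move=> a b c [m [n [-> -> ->]]]; split; apply/dG0; by eexists.
  - move=> a b /dG0[m ->] /dG0[n ->]; by exists (i (choice.pickle (m, n))), m, n.
(* Adjoining [G0] inside the property keeps the seed in the maximal graph and covers the empty
   chain. *)
have [F FP tF|G [pG Gmax]] := @Zorn_bigcup _ (fun G => pairing (G0 `|` G)).
  have [->|/set0P[X0 FX0]] := eqVneq F set0; first by rewrite bigcup_set0 setU0.
  have sub1 x : (G0 `|` \bigcup_(X in F) X) x -> exists2 X, F X & (G0 `|` X) x.
    by move=> [G0x|[X FX Xx]]; [exists X0 => //; left|exists X => //; right].
  have sub2 x y : (G0 `|` \bigcup_(X in F) X) x -> (G0 `|` \bigcup_(X in F) X) y ->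
      exists2 X, F X & (G0 `|` X) x /\ (G0 `|` X) y.
    move=> /sub1[X FX Xx] /sub1[Y FY Yy].
    have [s|s] := tF _ _ FX FY.
      by exists Y => //; split => //; case: Xx => [?|/s ?]; [left|right].
    by exists X => //; split => //; case: Yy => [?|/s ?]; [left|right].
  have up X x : F X -> (G0 `|` X) x -> (G0 `|` \bigcup_(X in F) X) x.
    by move=> FX [?|?]; [left|right; exists X].
  have upd X a : F X -> pairing_dom (G0 `|` X) a -> pairing_dom (G0 `|` \bigcup_(X in F) X) a.
    by move=> FX [c h]; exists c; exact: up FX h.
  split.
  - move=> p c c' h h'; have [X FX [X1 X2]] := sub2 _ _ h h'.
    by case: (FP _ FX) => + _ _ _; apply; eassumption.
  - move=> p p' c h h'; have [X FX [X1 X2]] := sub2 _ _ h h'.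
    by case: (FP _ FX) => _ + _ _; apply; eassumption.
  - move=> a b c /sub1[X FX h].
    by case: (FP _ FX) => _ _ /(_ _ _ _ h) [? ? ?] _; split; exact: (upd X).
  - move=> a b [c h] [c' h']; have [X FX [X1 X2]] := sub2 _ _ h h'.
    case: (FP _ FX) => _ _ _ /(_ a b) [||d Xd]; [by exists c|by exists c'|].
    by exists d; exact: up FX Xd.
set H := G0 `|` G in pG.
have [Hf Hi Hd Ht] := pG.
have /choice[f fP] (p : A * A) :
    exists c, pairing_dom H p.1 -> pairing_dom H p.2 -> H (p, c).
  case: p => a b.
  have [[ha hb]|h] := pselect (pairing_dom H a /\ pairing_dom H b).
    by have [c] := Ht _ _ ha hb; exists c.
  by exists a => /= ? ?; exfalso; apply: h.
have f_inj a b a' b' : pairing_dom H a -> pairing_dom H b -> pairing_dom H a' -> pairing_dom H b' ->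
    f (a, b) = f (a', b') -> a = a' /\ b = b'.
  move=> ha hb ha' hb' e.
  have := Hi (a, b) (a', b') (f (a, b)) (fP (a, b) ha hb).
  by rewrite e => /(_ (fP (a', b') ha' hb'))[].
have fB a b : pairing_dom H a -> pairing_dom H b -> pairing_dom H (f (a, b)).
  by move=> ha hb; have [] := Hd _ _ _ (fP (a, b) ha hb).
have iB n : pairing_dom H (i n) by exists (i (choice.pickle (n, n))); left; exists n, n.
have [[r [r1 r2]]|[r [r1 r2]]] := injection_total (~` pairing_dom H) (pairing_dom H).
  (* The tags [i 0] and [i 1] separate the images of [D] and of its complement. *)
  have /choice[j jP] a : exists b, (pairing_dom H a /\ b = f (i 0%N, a)) \/
      (~ pairing_dom H a /\ exists2 c, pairing_dom H c & r a c /\ b = f (i 1%N, c)).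
    have [ha|ha] := pselect (pairing_dom H a); first by exists (f (i 0%N, a)); left.
    by have [c ? ?] := r1 _ ha; exists (f (i 1%N, c)); right; split => //; exists c.
  have jB a : pairing_dom H (j a).
    by case: (jP a) => [[? ->]|[? [c ? [_ ->]]]]; exact: fB.
  have j_inj : injective j.
    move=> a b; case: (jP a) => [[ha ->]|[ha [c hc [rc ->]]]];
      case: (jP b) => [[hb ->]|[hb [d hd [rd ->]]]] /f_inj[]// e1 e2.
    - by have := i_inj _ _ e1.
    - by have := i_inj _ _ e1.
    - by apply: r2 rc _; rewrite e2.
  exists (fun p => f (j p.1, j p.2)) => -[a b] [a' b'] /= /f_inj[]//.
  by move=> /j_inj -> /j_inj ->.
have /choice[g gP] a : exists b, pairing_dom H a -> ~ pairing_dom H b /\ r a b.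
  have [/r1[b ? ?]|ha] := pselect (pairing_dom H a); first by exists b.
  by exists a.
(* [e false] is the identity, [e true] the passage to the copy of [D] in its complement. *)
pose e (s : bool) a := if s then g a else a.
have e_inj s t a b : pairing_dom H a -> pairing_dom H b -> e s a = e t b -> s = t /\ a = b.
  move=> ha hb; have [na ra] := gP _ ha; have [nb rb] := gP _ hb.
  case: s t => -[] //= h.
  - by split => //; apply: r2 ra _; rewrite h.
  - by case: na; rewrite h.
  - by case: nb; rewrite -h.
(* The three new blocks of the square, those with [s || t], are sent into the copy of [D]; the tag
   coding [(s, t)] tells them apart. *)
pose new (s t : bool) a b := g (f (i (choice.pickle (s, t)), f (a, b))).
pose H' := H `|` [set q | exists s t a b,
  [/\ pairing_dom H a, pairing_dom H b, s || t & q = (e s a, e t b, new s t a b)]].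
have newN s t a b : pairing_dom H a -> pairing_dom H b -> ~ pairing_dom H (new s t a b).
  by move=> ha hb; exact: (gP _ (fB _ _ (iB _) (fB _ _ ha hb))).1.
have new_inj s t a b s' t' a' b' : pairing_dom H a -> pairing_dom H b -> pairing_dom H a' -> pairing_dom H b' ->
    new s t a b = new s' t' a' b' -> [/\ s = s', t = t', a = a' & b = b'].
  move=> ha hb ha' hb' h.
  have hc := fB _ _ (iB (choice.pickle (s, t))) (fB _ _ ha hb).
  have hc' := fB _ _ (iB (choice.pickle (s', t'))) (fB _ _ ha' hb').
  have [_] := e_inj true true _ _ hc hc' h.
  move=> /(f_inj _ _ _ _ (iB _) (fB _ _ ha hb) (iB _) (fB _ _ ha' hb')) [].
  by move=> /i_inj /(pcan_inj choice.pickleK)[-> ->] /f_inj[].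
have dH' a : pairing_dom H' a <-> exists s b, pairing_dom H b /\ a = e s b.
  split=> [[c [h|[s [t [a' [b' [ha' hb' _ [-> _ _]]]]]]]]|[s [b [hb ->]]]].
  - by exists false, a; split => //; exists c.
  - by exists s, a'.
  - case: s; first by exists (new true true b b); right; exists true, true, b, b.
    by case: hb => c hc; exists c; left.
(* The extension is strict: [g (i 0)] lies in the domain of [H'] but not in that of [H]. *)
exfalso; apply: (Gmax H').
  split=> [x Gx|sub]; first by left; right.
  have := gP _ (iB 0%N) => -[+ _]; apply.
  have : G (g (i 0%N), g (i 0%N), new true true (i 0%N) (i 0%N)).
    by apply: sub; right; exists true, true, (i 0%N), (i 0%N).
  by move=> h; exists (new true true (i 0%N) (i 0%N)); right.
have -> : G0 `|` H' = H' by apply/setUidPr => x G0x; left; left.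
split.
- move=> p c c' [h|[s [t [a [b [ha hb st [ep ->]]]]]]]
    [h'|[s' [t' [a' [b' [ha' hb' st' []]]]]]].
  + exact: Hf h h'.
  + move: h => /[swap] -> /Hd [] h1 h2 _ _; exfalso.
    by case: s' st' h1 => [|] /=; [move=> _ /(gP _ ha').1|
      case: t' h2 => //= /(gP _ hb').1].
  + move: h'; rewrite ep => /Hd [] h1 h2 _; exfalso.
    by case: s st h1 {ep} => [|] /=; [move=> _ /(gP _ ha).1|
      case: t h2 => //= /(gP _ hb).1].
  + rewrite ep => -[] /e_inj[]// -> -> /e_inj[]// -> -> -> //.
- move=> p p' c [h|[s [t [a [b [ha hb st [-> ->]]]]]]]
    [h'|[s' [t' [a' [b' [ha' hb' st' []]]]]]].
  + exact: Hi h h'.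
  + by move=> _ ec; case: p h => x y /Hd[_ _]; rewrite ec => /(newN _ _ _ _ ha' hb').
  + by case: p' h' => x y /Hd[_ _] /(newN _ _ _ _ ha hb).
  + by move=> -> /new_inj[]// -> -> -> ->.
- move=> a b c [/Hd[? ? ?]|[s [t [a' [b' [ha hb st [-> -> ->]]]]]]].
    by split; apply/dH'; [exists false, a|exists false, b|exists false, c].
  split; apply/dH'; [by exists s, a'|by exists t, b'|].
  exists true, (f (i (choice.pickle (s, t)), f (a', b'))); split => //.
  exact: (fB _ _ (iB _) (fB _ _ ha hb)).
- move=> x y /dH'[s [a [ha ->]]] /dH'[t [b [hb ->]]].
  have [st|] := boolP (s || t).
    by exists (new s t a b); right; exists s, t, a, b.
  by case: s t => -[]//= _; exists (f (a, b)); left; exact: (fP (a, b)).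
Qed.

(** Lists are coded injectively by nested pairs, with [i 0] marking the empty list and [i 1] a cons.
    The map [d] is a left inverse of the coding, with value [[::]] off its image. *)
Lemma infinite_surj_seq (A : Type) (Q : countType) :
  infinite_set [set: A] -> exists d : A -> seq (A * Q), forall s, exists a, d a = s.
Proof.
move=> Ainf; have [p p_inj] := infinite_pairing Ainf.
have [i i_inj] := infinite_nat_inj Ainf.
pose code := foldr (fun (x : A * Q) c => p (i 1%N, p (p (x.1, i (choice.pickle x.2)), c)))
  (p (i 0%N, i 0%N)).
have code_inj : injective code.
  elim=> [|[a q] s IH] [|[b r] t] //= /p_inj[].
  - by move=> /i_inj.
  - by move=> /i_inj.
  - by move=> /p_inj[/p_inj[-> /i_inj /(pcan_inj choice.pickleK) ->] /IH ->].
have /choice[d dP] a : exists s, forall t, code t = a -> s = t.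
  have [[s <-]|h] := pselect (exists s, code s = a); first by exists s => t /code_inj.
  by exists [::] => t ta; case: h; exists t.
by exists d => s; exists (code s); exact: dP.
Qed.

(** * The l1 norm through finite sums *)

Section FiniteSums.
Variables (R : realType) (A : choiceType).
Implicit Types (y z : A -> R) (F G : {fset A}) (f : A -> R).

Lemma ler_sum_fset F G f : (forall a, 0 <= f a) -> (F `<=` G)%fset ->
  \sum_(a <- F) f a <= \sum_(a <- G) f a.
Proof.
move=> f0 FG; rewrite (big_fsetID _ (mem F) G) /=.
have -> : [fset x in G | x \in F]%fset = F.
  by apply/fsetP => a; rewrite !inE/= andb_idl// => /(fsubsetP FG).
by rewrite lerDl sumr_ge0.
Qed.

Lemma sum_fset_supp F G f : (forall a, a \notin F -> f a = 0) -> (F `<=` G)%fset ->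
  \sum_(a <- F) f a = \sum_(a <- G) f a.
Proof. by move=> f0 FG; apply: big_fset_incl => // a _ /f0. Qed.

Lemma esum_leP f (r : R) : (forall a, 0 <= f a) ->
  (\esum_(a in [set: A]) (f a)%:E <= r%:E)%E <->
  forall F, \sum_(a <- F) f a <= r.
Proof.
move=> f0; split=> [h F|h].
  rewrite -lee_fin -sumEFin; apply: le_trans h.
  apply: esum_ge; exists [set` F]; first by split.
  by rewrite fsbig_finite//= set_fsetK.
apply: ge_ereal_sup => _ [F [Ff _] <-].
by rewrite fsbig_finite//= sumEFin lee_fin.
Qed.

Lemma l1norm_leP y (r : R) :
  (l1norm y <= r%:E)%E <-> forall F, \sum_(a <- F) `|y a| <= r.
Proof. exact: esum_leP. Qed.

(** The norm itself, being finite, is the real [r']; the gap [r - r'] is the room used for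
    perturbations. *)
Lemma l1norm_lt_le y (r : R) : (l1norm y < r%:E)%E ->
  exists2 r', r' < r & (l1norm y <= r'%:E)%E.
Proof.
have : (0 <= l1norm y)%E by apply: esum_ge0 => a _; rewrite lee_fin.
by case: (l1norm y) => [s||]// _; rewrite lte_fin => sr; exists s.
Qed.

Lemma l1norm_pt y a (r : R) : (l1norm y <= r%:E)%E -> `|y a| <= r.
Proof. by move=> /l1norm_leP/(_ [fset a]%fset); rewrite big_seq_fset1. Qed.

Lemma l1distC y z : l1dist y z = l1dist z y.
Proof. by apply: eq_esum => a _; rewrite !fctE distrC. Qed.

Lemma l1dist_triangle y z w (r s : R) :
  (l1dist y z <= r%:E -> l1dist z w <= s%:E -> l1dist y w <= (r + s)%:E)%E.
Proof.
move=> /l1norm_leP h1 /l1norm_leP h2; apply/l1norm_leP => F.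
apply: le_trans (lerD (h1 F) (h2 F)); rewrite -big_split/= ler_sum// => a _.
by rewrite !fctE; apply: le_trans (ler_normD _ _); rewrite addrA subrK.
Qed.

Lemma l1norm_convex y z (t r : R) : 0 <= t -> t <= 1 ->
  (l1norm y <= r%:E -> l1norm z <= r%:E -> l1norm (t *: y + (1 - t) *: z)%R <= r%:E)%E.
Proof.
move=> t0 t1 /l1norm_leP h1 /l1norm_leP h2; apply/l1norm_leP => F.
apply: (@le_trans _ _ (t * \sum_(a <- F) `|y a| + (1 - t) * \sum_(a <- F) `|z a|)).
  rewrite !mulr_sumr -big_split/= ler_sum// => a _.
  rewrite !fctE; apply: le_trans (ler_normD _ _) _.
  by rewrite !normrZ (ger0_norm t0) ger0_norm// subr_ge0.
have := h1 F; have := h2 F; nra.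
Qed.

Lemma l1norm_sum (F : {fset A}) (c N : A -> R) (d : A -> A -> R) :
  (forall a, (l1norm (d a) <= (N a)%:E)%E) ->
  (l1norm (\sum_(a <- F) c a *: d a)%R <= (\sum_(a <- F) `|c a| * N a)%:E)%E.
Proof.
move=> dN; apply/l1norm_leP => G.
apply: (@le_trans _ _ (\sum_(b <- G) \sum_(a <- F) `|c a| * `|d a b|)).
  apply: ler_sum => b _; rewrite fct_sumE; apply: le_trans (ler_norm_sum _ _ _) _.
  by apply: ler_sum => a _; rewrite fctE normrZ.
rewrite exchange_big/=; apply: ler_sum => a _; rewrite -mulr_sumr ler_wpM2l//.
by have /l1norm_leP := dN a; exact.
Qed.

Lemma l1norm_supp y F : (forall a, a \notin F -> y a = 0) ->
  (l1norm y <= (\sum_(a <- F) `|y a|)%:E)%E.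
Proof.
move=> y0; apply/l1norm_leP => G.
rewrite [leRHS](@sum_fset_supp _ (F `|` G)%fset) ?fsubsetUl//.
  by apply: ler_sum_fset; rewrite ?fsubsetUr.
by move=> a /y0 ->; rewrite normr0.
Qed.

Lemma c00P y : @c00 R A y <-> exists F : {fset A}, forall a, a \notin F -> y a = 0.
Proof.
split=> [yf|[F yF]].
  exists (fset_set [set a | y a != 0]) => a; rewrite in_fset_set// notin_setE/=.
  by move=> /negP; rewrite negbK => /eqP.
apply: (@sub_finite_set _ _ [set` F]) => // a /=.
by apply: contraNT => /yF ->.
Qed.

Lemma c00_ell1 : @c00 R A `<=` @ell1 R A.
Proof. by move=> y /c00P[F /l1norm_supp h]; apply: le_lt_trans h (ltry _). Qed.

(** Entries with the same index add up, so that every list denotes a function. *)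
Definition rat_comb (s : seq (A * rat)) : A -> R :=
  fun b => \sum_(x <- s) (ratr x.2 *+ (x.1 == b)).

Lemma rat_comb_c00 s : c00 (rat_comb s).
Proof.
apply/c00P; exists [fset x in [seq x.1 | x <- s]]%fset => a.
rewrite inE /= => /mapP h.
rewrite /rat_comb big_seq big1// => x xs; case: eqP => //= e.
by case: h; exists x.
Qed.

(** A finite [F] carries the norm of [y] up to [e / 2], which bounds the tail; on [F] the rational
    approximations cost another [e / 2] in total. *)
Lemma rat_comb_dense y (e : R) : ell1 y -> 0 < e ->
  exists s, (l1dist y (rat_comb s) <= e%:E)%E.
Proof.
move=> y1 e0.
have [r yr] : exists r : R, l1norm y = r%:E.
  have : (0 <= l1norm y)%E by apply: esum_ge0 => a _; rewrite lee_fin.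
  by move: y1; rewrite /ell1/=; case: (l1norm y) => // r; exists r.
have [F hF] : exists F : {fset A}, r - e / 2 < \sum_(a <- F) `|y a|.
  apply: contrapT => /forallNP h.
  have : (l1norm y <= (r - e / 2)%:E)%E.
    by apply/l1norm_leP => F; rewrite leNgt; apply/negP/h.
  by rewrite yr lee_fin; lra.
(* The successor keeps the divisor nonzero when [F] is empty. *)
pose dlt := e / 2 / (#|` F|.+1)%:R.
have dlt0 : 0 < dlt by rewrite !divr_gt0.
have /choice[q qP] a : exists q : rat, `|y a - ratr q| <= dlt.
  have [q] := @rat_in_itvoo R (y a - dlt) (y a + dlt) ltac:(lra).
  rewrite in_itv/= => /andP[h1 h2]; exists q; rewrite ler_norml; apply/andP; split; lra.
exists [seq (a, q a) | a <- F].
have cE b : rat_comb [seq (a, q a) | a <- F] b = ratr (q b) *+ (b \in F).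
  rewrite /rat_comb big_map/=; case: (boolP (b \in F)) => bF.
    rewrite (big_fsetD1 b)//= eqxx big_seq big1 ?addr0// => a.
    by rewrite !inE => /andP[/negPf ->].
  by rewrite big_seq big1// => a aF; case: eqP => // ab; rewrite -ab aF in bF.
apply/l1norm_leP => G.
apply: (@le_trans _ _ (\sum_(a <- (F `|` G)%fset) `|(y - rat_comb [seq (a, q a) | a <- F]) a|)).
  by apply: ler_sum_fset; rewrite ?fsubsetUr.
have yFG : \sum_(a <- (F `|` G)%fset) `|y a| <= r.
  by move: {+}(F `|` G)%fset; apply/l1norm_leP; rewrite yr.
have FGE : [fset x in (F `|` G) | x \in F]%fset = F.
  by apply/fsetP => a; rewrite !inE/=; case: (a \in F); rewrite ?andbF.
move: yFG; rewrite !(big_fsetID _ (mem F) (F `|` G)%fset) /= FGE => yFG.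
have h1 : \sum_(a <- F) `|(y - rat_comb [seq (a, q a) | a <- F]) a| <= e / 2.
  apply: (@le_trans _ _ (\sum_(a <- F) dlt)).
    rewrite big_seq [leRHS]big_seq; apply: ler_sum => a aF.
    by rewrite !fctE cE aF mulr1n.
  rewrite big_const_seq count_predT iter_addr_0 -[leLHS]mulr_natr /dlt -mulrA.
  by apply: ler_piMr; [lra|rewrite ler_pdivrMl// mulr1 ler_nat].
have h2 : \sum_(a <- [fset x in (F `|` G) | x \notin F]%fset)
    `|(y - rat_comb [seq (a, q a) | a <- F]) a| =
    \sum_(a <- [fset x in (F `|` G) | x \notin F]%fset) `|y a|.
  rewrite big_seq [RHS]big_seq; apply: eq_bigr => a; rewrite !inE/= => /andP[_ aF].
  by rewrite !fctE cE (negPf aF) mulr0n subr0.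
rewrite h2; lra.
Qed.
End FiniteSums.

(** * Geometric convergence and finite intersections of neighborhoods *)

Section Limits.
Variable R : realType.

Lemma geometric_small (c e : R) : 0 < e -> exists n, c / 2 ^+ n < e.
Proof.
move=> e0.
have [n hn] : exists n : nat, c / e < n%:R.
  by exists (Num.truncn (c / e)).+1; exact: truncnS_gt.
exists n; rewrite ltr_pdivrMr ?exprn_gt0// mulrC -ltr_pdivrMr//.
apply: lt_le_trans hn _; rewrite -natrX ler_nat; exact/ltnW/ltn_expl.
Qed.

Lemma geometric_cvg (u : nat -> R) (c : R) :
  (forall n k, `|u (n + k)%N - u n| <= c / 2 ^+ n) -> cvgn u.
Proof.
move=> h; apply/cauchy_cvgP/cauchy_exP => e e0.
have [n hn] := geometric_small c e0; exists (u n); exists n => // m /= nm.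
by rewrite -ball_normE/= distrC -(subnKC nm); exact: le_lt_trans (h _ _) hn.
Qed.

Lemma near_seq (X : topologicalType) (T : eqType) (s : seq T) (P : T -> X -> Prop) (x : X) :
  (forall a, a \in s -> \forall x' \near x, P a x') ->
  \forall x' \near x, forall a, a \in s -> P a x'.
Proof.
elim: s => [|b s IH] h; first exact: nearW.
have hb := h b (mem_head _ _).
have hs : \forall x' \near x, forall a, a \in s -> P a x'.
  by apply: IH => a as_; apply: h; rewrite inE as_ orbT.
by near=> x' => a; rewrite inE => /orP[/eqP ->|]; [near: x'|move: a; near: x'].
Unshelve. all: by end_near. Qed.
End Limits.

(** * From selections to partitions of unity *)

Section SelectionToPartition.
Variables (R : realType) (X : topologicalType) (A : choiceType).
Variable S : set (A -> R).
Hypothesis c00S : @c00 R A `<=` S.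

(** A strong form of lower semicontinuity: the point [y] itself stays in the nearby values. *)
Definition open_fibers (Phi : X -> set (A -> R)) : Prop :=
  forall y x, Phi x y -> \forall x' \near x, Phi x' y.

Lemma open_fibers_lsc Phi : open_fibers Phi -> lsc S Phi.
Proof.
move=> oPhi U _; rewrite openE => x [y [Py Uy]].
by rewrite /interior/=; near=> x'; exists y; split => //; near: x'; exact: oPhi.
Unshelve. all: by end_near. Qed.

(** The selection property is applied, with [r / 2], to the intersection of [Phi x] with the open
    ball of radius [r] about [f x], nonempty because [f] is an [r]-selection. *)
Lemma refine_selection Phi (r : R) f :
  selection_property X S -> setvalued_into S Phi -> convex_valued Phi ->
  open_fibers Phi -> 0 < r -> continuous_into S f -> eps_selection Phi r f ->
  exists g, [/\ continuous_into S g, eps_selection Phi (r / 2) g &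
    forall x, (l1dist (g x) (f x) <= (2 * r)%:E)%E].
Proof.
move=> selS PhiS cPhi oPhi r0 [fS fc] fsel.
pose Psi x := Phi x `&` [set y | (l1dist y (f x) < r%:E)%E].
have [||||g [gc gsel]] := selS Psi _ _ _ (r / 2); last first.
- exists g; split => // x.
    by have [y [Py _] ?] := gsel x; exists y.
  have [y [_ /= yf] gy] := gsel x.
  have -> : 2 * r = r / 2 + (r + r / 2) by field.
  apply: le_trans (l1dist_triangle (ltW gy) (ltW yf)) _.
  by rewrite lee_fin; lra.
- lra.
(* If [y] is within [s < r] of [f x], it stays in the ball as long as [f] moves by less than
   [r - s]. *)
- apply: open_fibers_lsc => y x [Py /l1norm_lt_le[s sr ys]].
  have hP := oPhi _ _ Py.
  have hf := fc x (r - s) ltac:(lra).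
  near=> x'; split; first by near: x'.
  have /l1norm_lt_le[t tr h] : (l1dist (f x') (f x) < (r - s)%:E)%E by near: x'.
  rewrite /= l1distC; apply: le_lt_trans (l1dist_triangle h _) _.
    by rewrite l1distC; exact: ys.
  by rewrite lte_fin; lra.
- move=> x y z t [Py /l1norm_lt_le[s sr hy]] [Pz /l1norm_lt_le[s' sr' hz]] t0 t1.
  split; first exact: cPhi.
  apply: (@le_lt_trans _ _ (Num.max s s')%:E); last by rewrite lte_fin gt_max sr.
  have -> : l1dist (t *: y + (1 - t) *: z) (f x) =
      l1norm (t *: (y - f x) + (1 - t) *: (z - f x)).
    by congr l1norm; apply/funext => a; rewrite !fctE /GRing.scale/=; ring.
  apply: l1norm_convex => //.
    by apply: le_trans hy _; rewrite lee_fin le_max lexx.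
  by apply: le_trans hz _; rewrite lee_fin le_max lexx orbT.
- move=> x; split; last by move=> y [/(PhiS x).2].
  by have [y ? ?] := fsel x; exists y; split => //=; rewrite l1distC.
Unshelve. all: by end_near. Qed.

Lemma selection_sequence Phi :
  selection_property X S -> setvalued_into S Phi -> convex_valued Phi ->
  open_fibers Phi -> exists f : nat -> X -> A -> R,
  forall n, [/\ continuous_into S (f n), eps_selection Phi (1 / 2 ^+ n) (f n) &
    forall x, (l1dist (f n.+1 x) (f n x) <= (2 / 2 ^+ n)%:E)%E].
Proof.
move=> selS PhiS cPhi oPhi.
have [f0 [f0c f0s]] := selS Phi PhiS cPhi (open_fibers_lsc oPhi) (1 / 2 ^+ 0) ltac:(by []).
pose Q n f := continuous_into S f /\ eps_selection Phi (1 / 2 ^+ n) f.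
(* The step is chosen for all pairs, returning its argument where [Q] fails, so that plain recursion
   applies. *)
have /choice[step stepP] (p : nat * (X -> A -> R)) : exists g, Q p.1 p.2 ->
    Q p.1.+1 g /\ forall x, (l1dist (g x) (p.2 x) <= (2 / 2 ^+ p.1)%:E)%E.
  have [[h1 h2]|h] := pselect (Q p.1 p.2); last by exists p.2 => /h.
  have r0 : 0 < 1 / 2 ^+ p.1 :> R by rewrite divr_gt0// exprn_gt0.
  have [g [? gs gd]] := refine_selection selS PhiS cPhi oPhi r0 h1 h2.
  exists g => _; split; last by move=> x; have := gd x; rewrite mulrA mulr1.
  split => //; have -> // : 1 / 2 ^+ p.1.+1 = 1 / 2 ^+ p.1 / 2 :> R.
  by rewrite exprSr invfM; ring.
pose f := fix f n := if n is m.+1 then step (m, f m) else f0.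
have fQ n : Q n (f n) by elim: n => [//|n IH]; exact: (stepP (n, f n) IH).1.
by exists f => n; have [? ?] := fQ n; split => // x; exact: (stepP (n, f n) (fQ n)).2.
Qed.

(* The finitely supported convex combinations of the unit vectors [e_a] with [x \in U a]. *)
Definition cover_simplex (U : A -> set X) (x : X) : set (A -> R) :=
  [set y | exists F : {fset A}, [/\ forall a, a \in F -> U a x,
     forall a, a \notin F -> y a = 0, forall a, 0 <= y a & \sum_(a <- F) y a = 1]].

Lemma cover_simplex_setvalued U :
  open_cover_indexed U -> setvalued_into S (cover_simplex U).
Proof.
move=> [_ cU] x; split; last by move=> y [F [_ yF _ _]]; apply/c00S/c00P; exists F.
have [a _ Uax] : (\bigcup_(a in setT) U a) x by rewrite cU.
exists (fun b => (b == a)%:R), [fset a]%fset; split.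
- by move=> b; rewrite inE => /eqP ->.
- by move=> b; rewrite inE => /negPf ->.
- by move=> b; rewrite ler0n.
- by rewrite big_seq_fset1 eqxx.
Qed.

Lemma cover_simplex_convex U : convex_valued (cover_simplex U).
Proof.
move=> x y z t [F [FU yF y0 yS]] [G [GU zG z0 zS]] t0 t1.
exists (F `|` G)%fset; split.
- by move=> a; rewrite inE => /orP[/FU|/GU].
- move=> a; rewrite inE negb_or => /andP[/yF ya /zG za].
  by rewrite !fctE ya za !scaler0 addr0.
- by move=> a; rewrite !fctE addr_ge0// mulr_ge0// subr_ge0.
- transitivity (t * \sum_(a <- (F `|` G)%fset) y a +
      (1 - t) * \sum_(a <- (F `|` G)%fset) z a).
    by rewrite !mulr_sumr -big_split.
  rewrite -(sum_fset_supp yF) ?fsubsetUl// -(sum_fset_supp zG) ?fsubsetUr//.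
  by rewrite yS zS; ring.
Qed.

Lemma cover_simplex_open_fibers U :
  open_cover_indexed U -> open_fibers (cover_simplex U).
Proof.
move=> [oU _] y x [F [FU yF y0 yS]].
have : \forall x' \near x, forall a, a \in (F : seq A) -> U a x'.
  by apply: near_seq => a /FU Uax; apply: open_nbhs_nbhs; split.
by apply: filterS => x' FU'; exists F.
Qed.

Lemma selection_partition_of_unity (U : A -> set X) :
  selection_property X S -> open_cover_indexed U ->
  exists xi : A -> X -> R, partition_of_unity xi /\ index_subordinated xi U.
Proof.
move=> selS oU.
have [f fP] := selection_sequence selS (cover_simplex_setvalued oU)
  (@cover_simplex_convex U) (cover_simplex_open_fibers oU).
have p2 n : 0 < 2 ^+ n :> R by rewrite exprn_gt0.
(* The increments [2 / 2 ^+ n] telescope as differences of [4 / 2 ^+ n]. *)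
have fd n k x : (l1dist (f (n + k)%N x) (f n x) <= (4 / 2 ^+ n - 4 / 2 ^+ (n + k))%:E)%E.
  elim: k => [|k IH].
    rewrite addn0 subrr; apply/l1norm_leP => F.
    by rewrite big1// => a _; rewrite !fctE subrr normr0.
  rewrite addnS; have [_ _ /(_ x) h] := fP (n + k)%N.
  apply: le_trans (l1dist_triangle h IH) _; rewrite lee_fin exprSr invfM.
  have := p2 (n + k)%N; rewrite -invr_gt0; lra.
have fd4 n k x : (l1dist (f (n + k)%N x) (f n x) <= (4 / 2 ^+ n)%:E)%E.
  apply: le_trans (fd n k x) _; rewrite lee_fin gerBl divr_ge0// ltW//.
pose xi a x := limn (fun n => f n x a).
have cvf a x : cvgn (fun n => f n x a).
  by apply: (@geometric_cvg _ _ 4) => n k; have := l1norm_pt a (fd4 n k x).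
have xif n x (F : {fset A}) : \sum_(a <- F) `|xi a x - f n x a| <= 4 / 2 ^+ n.
  have cF : (fun m => \sum_(a <- F) `|f m x a - f n x a|) @ \oo -->
      \sum_(a <- F) `|xi a x - f n x a|.
    apply: cvg_big => [|a _]; first exact: add_continuous.
    by apply: cvg_norm; apply: cvgB; [exact: cvf|exact: cvg_cst].
  rewrite -(cvg_lim _ cF)//; apply: limr_le; first by apply/cvg_ex; eexists; exact: cF.
  exists n => // m /= nm; rewrite -(subnKC nm).
  by have /l1norm_leP := fd4 n (m - n)%N x; exact.
(* The error is [4 / 2 ^+ n] from the limit to [f n] and [1 / 2 ^+ n] from [f n] to the simplex. All
   properties of [xi] except continuity are passed on from such points [y]. *)
have xiy n x : exists2 y, cover_simplex U x y &
    forall F : {fset A}, \sum_(a <- F) `|xi a x - y a| <= 5 / 2 ^+ n.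
  have [_ /(_ x)[y Uy fy] _] := fP n; exists y => // F.
  have /l1norm_leP/(_ F) h := ltW fy.
  have -> : 5 / 2 ^+ n = 4 / 2 ^+ n + 1 / 2 ^+ n :> R by ring.
  apply: le_trans (lerD (xif n x F) h); rewrite -big_split/= ler_sum// => a _.
  by rewrite !fctE; apply: le_trans (ler_normD _ _); rewrite addrA subrK.
have xiy1 n x : exists2 y, cover_simplex U x y & forall a, `|xi a x - y a| <= 5 / 2 ^+ n.
  have [y ? h] := xiy n x; exists y => // a.
  by have := h [fset a]%fset; rewrite big_seq_fset1.
have small (t : R) : (forall n, t <= 5 / 2 ^+ n) -> t <= 0.
  move=> h; rewrite leNgt; apply/negP => /(geometric_small 5)[n].
  by apply/negP; rewrite -leNgt.
have xi0 a x : 0 <= xi a x.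
  rewrite -oppr_le0; apply: small => n; have [y [F [_ _ y0 _]] /(_ a)] := xiy1 n x.
  by have := y0 a; rewrite ler_norml => ? /andP[? ?]; lra.
have xiF x (F : {fset A}) : \sum_(a <- F) xi a x <= 1.
  rewrite -subr_le0; apply: small => n; have [y [G [_ yG y0 yS]] /(_ F)h] := xiy n x.
  have : \sum_(a <- F) y a <= 1.
    rewrite -yS (@sum_fset_supp _ _ G (F `|` G)%fset) ?fsubsetUr//.
    by apply: ler_sum_fset; rewrite ?fsubsetUl.
  move: h => /(le_trans (ler_norm_sum _ _ _)); rewrite sumrB ler_norml => /andP[_ ?] ?.
  lra.
exists xi; split; [split; [|split]|].
- move=> a x; apply/cvgrPdist_lt => e e0.
  (* Replacing [xi] by [f n] at both points costs twice [4 / 2 ^+ n]. *)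
  have [n hn] := @geometric_small R 8 (e / 2) ltac:(lra).
  have [[_ fc] _ _] := fP n.
  have := fc x (e / 2) ltac:(lra); apply: filterS => x' /ltW h.
  have {}h := l1norm_pt a h; rewrite !fctE in h.
  have := xif n x [fset a]%fset; have := xif n x' [fset a]%fset.
  rewrite !big_seq_fset1 => h1 h2.
  have h3 : `|xi a x - xi a x'| <= `|xi a x - f n x a| + `|f n x' a - f n x a| + `|xi a x' - f n x' a|.
    rewrite (distrC (f n x' a)) (distrC (xi a x')).
    by apply: le_trans (ler_distD (f n x' a) _ _) _; rewrite lerD2r ler_distD.
  apply: le_lt_trans h3 _; lra.
- by move=> a x; rewrite xi0/=; have := xiF x [fset a]%fset; rewrite big_seq_fset1.
- move=> x; apply/eqP; rewrite eq_le; apply/andP; split; first exact/esum_leP.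
  apply/lee_addgt0Pr => e e0.
  have [n hn] := @geometric_small R 5 e e0.
  have [y [G [_ yG y0 yS]] /(_ G)h] := xiy n x.
  have hG : ((\sum_(a <- G) xi a x)%:E <= \esum_(a in [set: A]) (xi a x)%:E)%E.
    rewrite -sumEFin; apply: esum_ge; exists [set` G]; first by split.
    by rewrite fsbig_finite//= set_fsetK.
  apply: le_trans (leeD2r _ hG); rewrite -EFinD lee_fin.
  move: h => /(le_trans (ler_norm_sum _ _ _)); rewrite sumrB yS ler_norml => /andP[? ?].
  lra.
- move=> a x /=; apply: contraNP => nU; rewrite -normr_le0.
  (* Outside [U a] every point of the simplex has coordinate [0] at [a]. *)
  apply: small => n; have [y [F [FU yF _ _]] /(_ a)] := xiy1 n x.
  by rewrite yF ?subr0//; apply/negP => /FU.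
Qed.

End SelectionToPartition.

(** * From partitions of unity to selections *)

Section PartitionToSelection.
Variables (R : realType) (X : topologicalType) (A : choiceType).

(** A finite sum exceeding [1 - e] at [x0] does so nearby by continuity; since the total is [1],
    each remaining term is then below [e]. *)
Lemma partition_tail (xi : A -> X -> R) (x0 : X) (e : R) :
  partition_of_unity xi -> 0 < e ->
  exists F : {fset A}, \forall x \near x0, forall a, a \notin F -> xi a x < e.
Proof.
move=> [xic [xi01 xi1]] e0.
have xi0 x a : 0 <= xi a x by have /andP[] := xi01 a x.
have [F hF] : exists F : {fset A}, 1 - e < \sum_(a <- F) xi a x0.
  apply: contrapT => /forallNP h.
  have : (\esum_(a in [set: A]) (xi a x0)%:E <= (1 - e)%:E)%E.
    by apply/esum_leP => // F; rewrite leNgt; apply/negP/h.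
  by rewrite xi1 lee_fin; lra.
exists F.
have cF : (fun x => \sum_(a <- F) xi a x) @ x0 --> \sum_(a <- F) xi a x0.
  by apply: cvg_big => [|a _]; [exact: add_continuous|exact: xic].
have nF : \forall x \near x0, 1 - e < \sum_(a <- F) xi a x.
  by apply: (cvgr_gt _ cF); exact: hF.
apply: filterS nF => x hx a aF.
have /esum_leP : (\esum_(a in [set: A]) (xi a x)%:E <= 1%:E)%E by rewrite xi1.
move=> /(_ (xi0 x) (a |` F)%fset); rewrite big_fsetU1//=; lra.
Qed.

(* Mather's trick: subtracting half of [sup_a xi a] truncates [xi] to a locally finite family. *)
Lemma partition_locally_finite (xi : A -> X -> R) : partition_of_unity xi ->
  exists m : A -> X -> R, [/\ forall a, continuous (m a), forall a x, 0 <= m a x,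
    forall a x, m a x != 0 -> xi a x != 0,
    forall x0 : X, exists F : {fset A}, \forall x \near x0, forall a, a \notin F -> m a x = 0 &
    forall x, exists a, 0 < m a x].
Proof.
move=> pxi; have [xic [xi01 xi1]] := pxi.
have xi0 a x : 0 <= xi a x by have /andP[] := xi01 a x.
have xpos x : exists a, 0 < xi a x.
  apply: contrapT => /forallNP h; have : (1 <= 0 :> \bar R)%E; last by rewrite lee_fin; lra.
  rewrite -(xi1 x) esum1// => a _; congr EFin; apply/eqP.
  by rewrite eq_le xi0 leNgt andbT; apply/negP/h.
pose sg x := sup (range (xi^~ x)).
have hs x : has_sup (range (xi^~ x)).
  split; first by have [a _] := xpos x; exists (xi a x), a.
  by exists 1 => _ [a _ <-]; have /andP[] := xi01 a x.
have le_sg a x : xi a x <= sg x by apply: (sup_upper_bound (hs x)); exists a.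
have sg0 x : 0 < sg x by have [a xa] := xpos x; exact: lt_le_trans xa (le_sg a x).
(* Equicontinuity of the family: finitely many indices are handled by continuity, and for the others
   both values lie in [[0, e)]. The supremum [sg] is therefore continuous. *)
have unif (x0 : X) e : 0 < e -> \forall x \near x0, forall a, `|xi a x - xi a x0| <= e.
  move=> e0; have [F hF] := partition_tail x0 pxi e0.
  have hF0 := nbhs_singleton hF.
  have hc : \forall x \near x0, forall a, a \in (F : seq A) -> `|xi a x - xi a x0| <= e.
    apply: near_seq => a _; have /cvgrPdist_le/(_ _ e0) := xic a x0.
    by apply: filterS => x; rewrite distrC.
  near=> x => a; have [aF|aF] := boolP (a \in F); first by move: a aF; near: x.
  have h1 : xi a x < e by move: a aF; near: x.
  have := hF0 _ aF; have := xi0 a x; have := xi0 a x0.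
  by move=> *; rewrite ler_norml; apply/andP; split; lra.
have sgc : continuous sg.
  move=> x0; apply/cvgrPdist_le => e e0.
  have := unif x0 e e0; apply: filterS => x hx; rewrite ler_norml; apply/andP; split.
    rewrite lerBrDr addrC lerBlDr.
    apply: ge_sup; first exact: (hs x).1.
    by move=> _ [a _ <-]; have := hx a; have := le_sg a x0; rewrite ler_norml => ? /andP[]; lra.
  rewrite lerBlDr; apply: ge_sup; first exact: (hs x0).1.
  by move=> _ [a _ <-]; have := hx a; have := le_sg a x; rewrite ler_norml => ? /andP[]; lra.
pose m a x := Num.max (xi a x - sg x / 2) 0.
exists m; split.
- move=> a x.
  apply: (@continuous_max R X (fun x => xi a x - sg x / 2) (fun=> 0) x); last exact: cvg_cst.
  by apply: cvgB; [exact: xic|apply: cvgMl; exact: sgc].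
- by move=> a x; rewrite /m le_max lexx orbT.
- move=> a x; apply: contraNneq => xa; apply/eqP; rewrite /m xa; apply/max_idPr.
  by have := sg0 x; lra.
(* Near [x0], [sg x / 2] is at least [3/8] of [sg x0], above the bound [sg x0 / 4] on the tail. *)
- move=> x0; have s4 : 0 < sg x0 / 4 by have := sg0 x0; lra.
  have [F hF] := partition_tail x0 pxi s4; exists F.
  have /cvgrPdist_le/(_ _ s4) hs0 := sgc x0.
  near=> x => a aF; apply/max_idPr.
  have h1 : xi a x < sg x0 / 4 by move: a aF; near: x.
  have : `|sg x0 - sg x| <= sg x0 / 4 by near: x.
  by rewrite ler_norml => /andP[? ?]; lra.
- move=> x.
  have [_ [a _ <-] h] := sup_adherent (ltac:(have := sg0 x; lra) : 0 < sg x / 2) (hs x).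
  exists a; rewrite /m lt_max; apply/orP; left; move: h; rewrite -/(sg x); lra.
Unshelve. all: by end_near. Qed.

(** Induction on [s]: the barycenter is a convex combination of [d b] and that of the tail, with
    coefficient [w b / (w b + W)]. Zero weights are split off, as [d b] may then lie outside [C]. *)
Lemma convex_set_barycenter (C : set (A -> R)) (s : seq A) (w : A -> R) (d : A -> A -> R) :
  Defs.convex_set C -> (forall a, 0 <= w a) -> (forall a, w a != 0 -> C (d a)) ->
  0 < \sum_(a <- s) w a ->
  C ((\sum_(a <- s) w a)^-1 *: \sum_(a <- s) w a *: d a).
Proof.
move=> cC w0 Cd; elim: s => [|b s IH]; first by rewrite big_nil ltxx.
rewrite !big_cons; set W := \sum_(a <- s) w a in IH *.
have W0 : 0 <= W by exact: sumr_ge0.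
have [wb|wb] := eqVneq (w b) 0; first by rewrite wb add0r scale0r add0r.
move: W0; rewrite le_eqVlt => /predU1P[W0 _|W0 _].
  have -> : \sum_(a <- s) w a *: d a = 0.
    move/esym/eqP: W0; rewrite psumr_eq0// => /allP ws.
    by rewrite big_seq big1// => a /ws/= /eqP ->; rewrite scale0r.
  by rewrite -W0 !addr0 scalerA mulVf// scale1r; exact: Cd.
have wb0 : 0 < w b by rewrite lt_def wb w0.
have t0 : 0 <= w b / (w b + W) by rewrite divr_ge0// addr_ge0// ltW.
have t1 : w b / (w b + W) <= 1 by rewrite ler_pdivrMr ?mul1r ?lerDl ?ltW// addr_gt0.
have := cC _ _ _ (Cd b wb) (IH W0) t0 t1; congr C.
rewrite scalerDr !scalerA; congr (_ *: _ + _ *: _); first by rewrite mulrC.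
have ? := lt0r_neq0 wb0; have ? := lt0r_neq0 W0.
field; apply/andP; split => //; exact: lt0r_neq0 (addr_gt0 wb0 W0).
Qed.

(** The set [Fs x] chosen at each point varies arbitrarily, but the barycenter does not depend on
    it, so one [F] serves near [x0]. There the normalized weights are continuous, and the distance
    is bounded by their variations weighted with bounds [N a] on the norms of [d a]. *)
Lemma locally_finite_barycenter (m : A -> X -> R) (d : A -> A -> R) :
  (forall a, c00 (d a)) -> (forall a, continuous (m a)) -> (forall a x, 0 <= m a x) ->
  (forall x0 : X, exists F : {fset A}, \forall x \near x0, forall a, a \notin F -> m a x = 0) ->
  (forall x, exists a, 0 < m a x) ->
  exists f : X -> A -> R, [/\ forall x, c00 (f x),
    forall (x : X) (e : R), 0 < e -> \forall x' \near x, (l1dist (f x') (f x) < e%:E)%E &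
    forall x (C : set (A -> R)), Defs.convex_set C -> (forall a, m a x != 0 -> C (d a)) -> C (f x)].
Proof.
move=> dc mc m0 mlf mpos.
have /choice[Fs FsP] x : exists F : {fset A}, forall a, a \notin F -> m a x = 0.
  by have [F hF] := mlf x; exists F; exact: nbhs_singleton hF.
pose bary (F : {fset A}) x := (\sum_(a <- F) m a x)^-1 *: \sum_(a <- F) m a x *: d a.
have baryE (F G : {fset A}) x : (forall a, a \notin F -> m a x = 0) ->
    (forall a, a \notin G -> m a x = 0) -> bary F x = bary G x.
  move=> hF hG; suff E H : (forall a, a \notin H -> m a x = 0) -> (H `<=` F `|` G)%fset ->
      bary H x = bary (F `|` G)%fset x.
    by rewrite (E F) ?fsubsetUl// -(E G) ?fsubsetUr.
  move=> hH sH; rewrite /bary (sum_fset_supp hH sH); congr (_ *: _).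
  by apply: big_fset_incl => // a _ /hH ->; rewrite scale0r.
have pos (F : {fset A}) x : (forall a, a \notin F -> m a x = 0) -> 0 < \sum_(a <- F) m a x.
  move=> hF; have [a ma] := mpos x; apply: lt_le_trans ma _.
  have -> : m a x = \sum_(b <- [fset a]%fset) m b x by rewrite big_seq_fset1.
  rewrite [leRHS](@sum_fset_supp _ _ _ (a |` F)%fset) ?fsubsetU1//.
  by apply: ler_sum_fset => //; rewrite fsub1set fset1U1.
have dell a : exists N : R, (l1norm (d a) <= N%:E)%E.
  by have /c00P[F /l1norm_supp h] := dc a; eexists; exact: h.
have /choice[N NP] := dell.
exists (fun x => bary (Fs x) x); split.
- move=> x; have /choice[G GP] a := (c00P _).1 (dc a).
  apply/c00P; exists (\bigcup_(a <- Fs x) G a)%fset => b hb.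
  rewrite /bary fctE; suff -> : (\sum_(a <- Fs x) m a x *: d a) b = 0 by rewrite scaler0.
  rewrite fct_sumE big_seq big1// => a aF.
  rewrite fctE GP ?scaler0//; apply: contraNN hb => bG.
  by apply/bigfcupP; exists a => //; rewrite aF.
- move=> x0 e e0; have [F hF] := mlf x0.
  have hF0 := nbhs_singleton hF.
  pose c a x := m a x / \sum_(b <- F) m b x.
  have bE x : bary F x = \sum_(a <- F) c a x *: d a.
    by rewrite /bary scaler_sumr; apply: eq_bigr => a _; rewrite scalerA mulrC.
  have cc a : c a x @[x --> x0] --> c a x0.
    apply: cvgM; first exact: mc.
    apply: cvgV; first exact: lt0r_neq0 (pos _ _ hF0).
    by apply: cvg_big => [|b _]; [exact: add_continuous|exact: mc].
  have cv : (\sum_(a <- F) `|c a x - c a x0| * N a) @[x --> x0] -->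
      \sum_(a <- F) `|c a x0 - c a x0| * N a.
    apply: cvg_big => [|b _]; first exact: add_continuous.
    by apply: cvgMl; apply: cvg_norm; apply: cvgB; [exact: cc|exact: cvg_cst].
  have lim0 : \sum_(a <- F) `|c a x0 - c a x0| * N a < e.
    by rewrite big1// => a _; rewrite subrr normr0 mul0r.
  have hcv : \forall x \near x0, \sum_(a <- F) `|c a x - c a x0| * N a < e.
    by apply: (cvgr_lt _ cv); exact: lim0.
  near=> x.
  have hx a : a \notin F -> m a x = 0 by move: a; near: x.
  rewrite /= (baryE _ _ _ (FsP x) hx) (baryE _ _ _ (FsP x0) hF0).
  have -> : l1dist (bary F x) (bary F x0) =
      l1norm (\sum_(a <- F) (c a x - c a x0) *: d a).
    rewrite /l1dist !bE -sumrB; congr l1norm; apply: eq_bigr => a _.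
    by rewrite scalerBl.
  apply: le_lt_trans (l1norm_sum _ _ NP) _; rewrite lte_fin.
  by near: x.
- move=> x C cC hC; apply: convex_set_barycenter => //.
  exact: pos (FsP x).
Unshelve. all: by end_near. Qed.

Lemma partition_of_unity_selection (S : set (A -> R)) :
  infinite_set [set: A] -> @c00 R A `<=` S -> S `<=` @ell1 R A ->
  (forall U : A -> set X, open_cover_indexed U ->
    exists xi : A -> X -> R, partition_of_unity xi /\ index_subordinated xi U) ->
  selection_property X S.
Proof.
move=> Ainf c00S Sell pou Phi PhiS cPhi lPhi e e0.
have [dec decP] := infinite_surj_seq rat Ainf.
pose d a : A -> R := rat_comb R (dec a).
have dc a : c00 (d a) by exact: rat_comb_c00.
pose B a := [set y | S y /\ (l1dist y (d a) < (e / 2)%:E)%E].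
have oB a : open_in S (B a).
  split=> [y []//|y [Sy /l1norm_lt_le[r rd yd]]].
  exists (e / 2 - r); first lra.
  move=> z Sz /l1norm_lt_le[s sr zy]; split => //.
  by apply: le_lt_trans (l1dist_triangle zy yd) _; rewrite lte_fin; lra.
pose U a := [set x | Phi x `&` B a !=set0].
have [|xi [pxi sxi]] := pou U.
  split; first by move=> a; apply: lPhi.
  apply/seteqP; split => // x _.
  have [[y Py] PS] := PhiS x.
  have [s ys] := rat_comb_dense (Sell _ (PS _ Py)) (ltac:(lra) : 0 < e / 4).
  have [a da] := decP s.
  exists a => //; exists y; split => //; split; first exact: PS.
  by rewrite /d da; apply: le_lt_trans ys _; rewrite lte_fin; lra.
have [m [mc m0 mxi mlf mpos]] := partition_locally_finite pxi.
have [f [fc00 fc fC]] := locally_finite_barycenter dc mc m0 mlf mpos.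
exists f; split; first by split => // x; exact: c00S.
move=> x.
(* The closed [e / 2]-neighborhood of [Phi x] is convex and contains each [d a] of nonzero weight at
   [x], hence also the barycenter. *)
pose C := [set z | exists2 y, Phi x y & (l1dist z y <= (e / 2)%:E)%E].
have : C (f x).
  apply: fC => [z z' t [y Py zy] [y' Py' zy'] t0 t1|a /mxi/sxi [y [Py [_ yd]]]].
    exists (t *: y + (1 - t) *: y'); first exact: cPhi.
    have -> : l1dist (t *: z + (1 - t) *: z') (t *: y + (1 - t) *: y') =
        l1norm (t *: (z - y) + (1 - t) *: (z' - y')).
      by congr l1norm; apply/funext => a; rewrite !fctE /GRing.scale/=; ring.
    exact: l1norm_convex.
  by exists y => //; rewrite l1distC ltW.
move=> [y Py h]; exists y => //; apply: le_lt_trans h _; rewrite lte_fin; lra.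
Qed.

End PartitionToSelection.

Theorem theorem4p4 (R : realType) (X : topologicalType) (A : choiceType)
  (hA : infinite_set [set: A]) :
  (selection_property X (@c00 R A) <-> selection_property X (@ell1 R A)) /\
  (selection_property X (@ell1 R A) <->
    forall U : A -> set X, open_cover_indexed U ->
      exists xi : A -> X -> R, partition_of_unity xi /\ index_subordinated xi U).
Proof.
have cl := @c00_ell1 R A.
have toU S (cS : @c00 R A `<=` S) (selS : selection_property X S) U oU :=
  selection_partition_of_unity cS selS oU (U := U).
have toS S := @partition_of_unity_selection R X A S hA.
(* The two selection properties are linked through the partition property. *)
split; split.
- by move=> /(toU _ (@subset_refl _ _)); exact: toS.
- by move=> /(toU _ cl); exact: toS.
- exact: toU.
- exact: toS.
Qed.
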